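(* Let $K$ be an infinite field (of arbitrary characteristic), let $S=K[x_1,\ldots,x_n]$, let $\Delta$ be a stable simplicial complex on $[n]$, and let $\Delta^c$ be a combinatorial shifted complex of $\Delta$. Then for all $i$ and $j$, $$\beta_{i,j}(I_\Delta)=\beta_{i,j}(I_{\Delta^c}).$$
   Context: $[n]=\{1,\ldots,n\}$. A simplicial complex $\Delta$ on $[n]$ is a set of subsets of $[n]$, closed under taking subsets, with $\{i\}\in\Delta$ for all $i\in[n]$. Put $\nabla=\nabla(\Delta)=\{\sigma\subseteq[n]:\sigma\notin\Delta\}$. For $\sigma\subseteq[n]$ let $x_\sigma=\prod_{i\in\sigma}x_i$. The Stanley-Reisner ideal $I_\Delta\subseteq S$ is generated by all $x_\sigma$ with $\sigma\in\nabla$; an ideal generated by squarefree monomials of degree at least $2$ equals $I_{\Delta_1}$ for a unique simplicial complex $\Delta_1$ on $[n]$. For a graded ideal $I$, $\beta_{i,j}(I)$ is the graded Betti number: the minimal graded free $S$-resolution of $I$ has $i$-th term $\bigoplus_j S(-j)^{\beta_{i,j}(I)}$. For a monomial $u\ne1$, $m(u)=\max\{i:x_i\mid u\}$. A monomial ideal generated by squarefree monomials is squarefree stable if for every squarefree monomial $u\neq 1$ in it and every $i<m(u)$ with $x_i\nmid u$, the monomial $x_i(u/x_{m(u)})$ is in it. $\Delta$ is stable if $I_\Delta$ is squarefree stable. For $1\le k<l\le n$ and $\sigma\in\nabla$ put $S_{kl}(\sigma)=(\sigma\setminus\{l\})\cup\{k\}$ if $l\in\sigma$, $k\notin\sigma$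 and $(\sigma\setminus\{l\})\cup\{k\}\notin\nabla$, and $S_{kl}(\sigma)=\sigma$ otherwise. $\mathrm{Shift}_{kl}(\Delta)$ is the simplicial complex on $[n]$ whose Stanley-Reisner ideal is generated by all $x_{S_{kl}(\sigma)}$ with $\sigma\in\nabla$. A simplicial complex $\Gamma$ on $[n]$ is shifted if for all $\sigma\in\Gamma$, $i\in\sigma$ and $j>i$ one has $(\sigma\setminus\{i\})\cup\{j\}\in\Gamma$. A combinatorial shifted complex $\Delta^c$ of $\Delta$ is a shifted complex of the form $\Delta^c=\mathrm{Shift}_{k_rl_r}(\mathrm{Shift}_{k_{r-1}l_{r-1}}(\cdots(\mathrm{Shift}_{k_1l_1}(\Delta))\cdots))$ for some $r\ge1$ and pairs $k_t<l_t$, $t=1,\ldots,r$ (at each step $\nabla$ is taken with respect to the current complex). *)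

(* Defs.v *)
From HB Require Import structures.
From mathcomp Require Import all_boot all_order all_algebra.
From mathcomp Require Import mpoly.
From Stdlib Require Import ClassicalEpsilon.

Set Implicit Arguments.
Unset Strict Implicit.
Unset Printing Implicit Defensive.

Import GRing.Theory.
Local Open Scope ring_scope.

(* The vertex set [n] is 'I_n, so that indices start at 0.                    *)

Definition infinite_field (K : fieldType) : Prop :=
  forall s : seq K, exists x : K, x \notin s.

Definition simplicial_complex n (D : {set {set 'I_n}}) : Prop :=
  (forall s t : {set 'I_n}, s \in D -> t \subset s -> t \in D)
  /\ (forall i : 'I_n, [set i] \in D).

Definition nonfaces n (D : {set {set 'I_n}}) : {set {set 'I_n}} := ~: D.

Definition sqfree_monomial (K : fieldType) n (s : {set 'I_n}) : {mpoly K[n]} :=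
  \prod_(i in s) 'X_i.

Definition ideal_generated (K : fieldType) n (T : finType) (A : {set T})
    (g : T -> {mpoly K[n]}) (p : {mpoly K[n]}) : Prop :=
  exists c : T -> {mpoly K[n]}, p = \sum_(t in A) c t * g t.

Definition stanley_reisner (K : fieldType) n (D : {set {set 'I_n}}) :
    {mpoly K[n]} -> Prop :=
  ideal_generated (nonfaces D) (@sqfree_monomial K n).
Arguments stanley_reisner K {n} D _.

(* [max_var u l] says m(u) = l; such an l exists exactly when u is not 1.     *)
Definition max_var n (u : 'X_{1..n}) (l : 'I_n) : Prop :=
  (0 < u l)%N /\ forall j : 'I_n, (0 < u j)%N -> (j <= l)%N.

(* Since x_l divides u, the truncated difference u - U_(l) is the exact       *)
(* exponent of u / x_l.                                                       *)
Definition squarefree_stable (K : fieldType) n (I : {mpoly K[n]} -> Prop) :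
    Prop :=
  forall (u : 'X_{1..n}) (l i : 'I_n),
    (forall j : 'I_n, (u j <= 1)%N) -> max_var u l -> I 'X_[u] ->
    (i < l)%N -> u i = 0%N -> I 'X_[U_(i) + (u - U_(l))].

Definition stable_complex (K : fieldType) n (D : {set {set 'I_n}}) : Prop :=
  squarefree_stable (stanley_reisner K D).

Definition shift_set n (D : {set {set 'I_n}}) (k l : 'I_n) (s : {set 'I_n}) :
    {set 'I_n} :=
  if [&& l \in s, k \notin s & (k |: (s :\ l)) \notin nonfaces D]
  then k |: (s :\ l) else s.

(* [is_shift K k l D D'] says D' = Shift_kl(D): the complex D' is determined  *)
(* by its Stanley-Reisner ideal.                                              *)
Definition is_shift (K : fieldType) n (k l : 'I_n) (D D' : {set {set 'I_n}}) :
    Prop :=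
  simplicial_complex D'
  /\ forall p : {mpoly K[n]},
       stanley_reisner K D' p
       <-> ideal_generated (nonfaces D)
             (fun s => sqfree_monomial K (shift_set D k l s)) p.

Inductive iterated_shift (K : fieldType) n (D : {set {set 'I_n}}) :
    {set {set 'I_n}} -> Prop :=
| Shift_one (k l : 'I_n) D' :
    (k < l)%N -> is_shift K k l D D' -> iterated_shift K D D'
| Shift_next (k l : 'I_n) D' D'' :
    iterated_shift K D D' -> (k < l)%N -> is_shift K k l D' D'' ->
    iterated_shift K D D''.

Definition shifted_complex n (G : {set {set 'I_n}}) : Prop :=
  forall (s : {set 'I_n}) (i j : 'I_n),
    s \in G -> i \in s -> (i < j)%N -> (j |: (s :\ i)) \in G.

Definition combinatorial_shifted (K : fieldType) n
    (D Dc : {set {set 'I_n}}) : Prop :=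
  iterated_shift K D Dc /\ shifted_complex Dc.

(* A sequence ... -> F_1 -> F_0 -> S of maps of free modules of finite rank   *)
(* over S = K[x_1, ..., x_n]. Elements of F_i are row vectors and maps act by *)
(* right multiplication; the a-th basis vector of F_i has degree              *)
(* [res_deg i a], i.e. F_i is the direct sum of the S(- res_deg i a). Natural *)
(* numbers suffice as degrees, since minimal generators of syzygies of an     *)
(* ideal of S live in nonnegative degrees.                                    *)
Record free_complex (K : fieldType) n := FreeComplex {
  res_rank : nat -> nat;
  res_deg : forall i, 'I_(res_rank i) -> nat;
  res_aug : 'cV[{mpoly K[n]}]_(res_rank 0);
  res_diff : forall i, 'M[{mpoly K[n]}]_(res_rank i.+1, res_rank i)
}.

(* F resolves I, with F_0 mapping onto I, by maps of degree 0, and the image  *)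
(* of each F_(i+1) lies in (x_1, ..., x_n) F_i.                               *)
Record minimal_graded_resolution (K : fieldType) n
    (I : {mpoly K[n]} -> Prop) (F : free_complex K n) : Prop := {
  aug_homog : forall a, res_aug F a 0 \is (res_deg a).-homog;
  diff_homog : forall i a b,
    res_diff F i a b = 0
    \/ ((res_deg b <= res_deg a)%N
        /\ res_diff F i a b \is (res_deg a - res_deg b).-homog);
  aug_image : forall p, I p <-> exists v : 'rV_(res_rank F 0),
    p = (v *m res_aug F) 0 0;
  aug_exact : forall v : 'rV_(res_rank F 0),
    v *m res_aug F = 0 <-> exists w, v = w *m res_diff F 0;
  diff_exact : forall i (v : 'rV_(res_rank F i.+1)),
    v *m res_diff F i = 0 <-> exists w, v = w *m res_diff F i.+1;
  diff_minimal : forall i a b, (res_diff F i a b)@_0%MM = 0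
}.

(* The number of summands S(-j) in the i-th term of a minimal graded free     *)
(* resolution of I, with an unspecified value if I has no such resolution     *)
(* (which never happens for a graded ideal).                                  *)
Definition graded_betti (K : fieldType) n (I : {mpoly K[n]} -> Prop)
    (i j : nat) : nat :=
  epsilon (inhabits 0%N) (fun b => exists F : free_complex K n,
    minimal_graded_resolution I F
    /\ b = #|[set a : 'I_(res_rank F i) | res_deg a == j]|).

(* Main.v *)
Require Import Defs.
From mathcomp Require Import all_boot all_order all_algebra.
From mathcomp Require Import mpoly.
From Stdlib Require Import ClassicalEpsilon.

(** Let N be the family of nonfaces of a stable complex.  The graded Betti
    numbers of its Stanley-Reisner ideal are
      beta_(i, j) = sum of 'C(m(u) - |u|, i) over the inclusion-minimal u in N
                    with |u| + i = j,
    where m(u) is the largest vertex of u counted from 1.  So they depend only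
    on how many minimal nonfaces there are of each pair (size, largest vertex),
    and the proof has two halves.

    Combinatorics.  A shift S_kl of a stable family is again stable
    ([stable_shift]), and S_kl is injective on N, keeps sizes, and keeps largest
    vertices as well: if l were the largest vertex of s, stability would already
    put (s \ l) + k in N, and s would not move.  Hence N and its shift have the
    same number of members of each size and largest vertex
    ([sum_shift_nonfaces]).  The same then holds for the minimal members, since
    a non-minimal s in a stable family is exactly t + l for a member t all of
    whose vertices are below l ([sum_min_sets]).  An induction over the
    sequence of shifts follows.

    Algebra.  Sorting the minimal nonfaces of a stable family by size and then
    by largest vertex gives linear quotients: the ideal generated by the
    monomials before x_u, divided by x_u, is generated by the variables x_k with
    k < m(u) and k not in u ([stable_linear_quotients]).  Adding the generators
    one at a time, a mapping cone over the Koszul complex of those variables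
    turns a minimal resolution into a minimal resolution; minimality survives
    because the comparison map strictly lowers twists ([mapping_cone]).  The
    Koszul complexes themselves arise from the same cone construction
    ([variables_resolution]).  This yields a resolution with the ranks above.
    Any two minimal graded resolutions have the same ranks, because lifting the
    identity in both directions gives maps that are inverse to each other
    modulo the maximal ideal ([betti_le]). *)

Set Implicit Arguments.
Unset Strict Implicit.
Unset Printing Implicit Defensive.

Import GRing.Theory.

(** * Stable families of sets and linear quotients *)

Section StableFamilies.
Variables (n : nat).
Implicit Types (N : {set {set 'I_n}}) (s t u v w X : {set 'I_n}) (i j k l : 'I_n).

Definition up_closed N := forall s t, s \in N -> s \subset t -> t \in N.

(** m(u) in 1-based counting, so that the empty set gets the value 0 and needs
    no separate treatment. *)
Definition set_top s := \max_(i in s) i.+1.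

Definition stable_family N := forall s l i,
  s \in N -> l \in s -> set_top s = l.+1 -> i < l -> i \notin s ->
  i |: (s :\ l) \in N.

Lemma set_top_leP s b : reflect {in s, forall i, i < b} (set_top s <= b).
Proof. exact: bigmax_leqP. Qed.

Lemma ltn_set_top s i : i \in s -> i < set_top s.
Proof. by move=> si; rewrite /set_top (bigD1 i) //= leq_maxl. Qed.

Lemma set_top_eq s l : l \in s -> {in s, forall i, i <= l} -> set_top s = l.+1.
Proof. by move=> ls h; apply/eqP; rewrite eqn_leq ltn_set_top // andbT; apply/set_top_leP. Qed.

Lemma set_top_max s i : i \in s -> exists2 l, l \in s & set_top s = l.+1.
Proof.
move=> si; case: (arg_maxnP (fun k : 'I_n => k : nat) si) => l ls h.
by exists l => //; apply: set_top_eq => // k; apply: h.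
Qed.

Lemma card_swap s i l : l \in s -> i \notin s -> #|i |: (s :\ l)| = #|s|.
Proof. by move=> ls si; rewrite cardsU1 !inE (negbTE si) andbF add1n [RHS](cardsD1 l) ls. Qed.

Definition min_sets N := [set s in N | [forall x in s, s :\ x \notin N]].

Lemma min_setsP N s : up_closed N ->
  reflect (s \in N /\ forall t, t \in N -> t \subset s -> t = s) (s \in min_sets N).
Proof.
move=> hN; rewrite inE; apply: (iffP andP) => -[sN h]; split=> //.
  move=> t tN ts; apply/eqP; rewrite eqEsubset ts; apply/subsetP=> x xs.
  apply: contraTT (forall_inP h x xs) => xt; rewrite negbK; apply: hN tN _.
  by rewrite subsetD1 ts.
apply/forall_inP=> x xs; apply/negP=> /h /(_ (subD1set _ _)) /setP/(_ x).
by rewrite !inE eqxx xs.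
Qed.

Lemma min_sets_below N s : s \in N -> exists2 t, t \in min_sets N & t \subset s.
Proof.
elim: {s}_.+1 {-2}s (ltnSn #|s|) => // m IH s hs sN.
have [|] := boolP (s \in min_sets N); first by exists s.
rewrite inE sN /= => /forall_inPn[x xs]; rewrite negbK => /IH[|t tG ts].
  by rewrite -ltnS; apply: leq_trans hs; rewrite ltnS [in X in _ < X](cardsD1 x) xs.
by exists t => //; apply: subset_trans ts (subD1set _ _).
Qed.

(** Repeatedly trading the largest vertex of v, which lies above u, for a vertex
    of u missing from v pushes v inside u; |v| <= |u| guarantees that such a
    vertex exists. *)
Lemma stable_exchange N u v : stable_family N ->
  v \in N -> #|v| <= #|u| -> {in v :\: u, forall k, set_top u <= k} ->
  exists w, [/\ w \in N, w \subset u & #|w| = #|v|].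
Proof.
move=> hN; elim: {v}_.+1 {-2}v (ltnSn #|v :\: u|) => // m IH v hm vN vu hv.
(* v is strictly reduced outside u by trading its largest vertex l for i. *)
have [vu0|[k kvu]] := set_0Vmem (v :\: u).
  by exists v; split=> //; rewrite -setD_eq0 vu0.
move: (kvu); rewrite inE => /andP[ku kv].
have [l lv topv] := set_top_max kv.
have ul : set_top u <= l.
  by apply: leq_trans (hv k kvu) _; rewrite -ltnS -topv ltn_set_top.
have lu : l \notin u by apply: contraTN ul => /ltn_set_top; rewrite ltnNge.
have [i iu] : exists i, i \in u :\: v.
  apply/set0Pn; rewrite -card_gt0 cardsD subn_gt0.
  apply: leq_trans vu; rewrite -(cardsID u v) setIC -[X in X < _]addn0 ltn_add2l.
  by rewrite card_gt0; apply/set0Pn; exists k.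
move: iu; rewrite inE => /andP[iv iu].
have il : i < l by apply: leq_trans (ltn_set_top iu) ul.
have sub : (i |: (v :\ l)) :\: u \proper v :\: u.
  apply/properP; split.
    apply/subsetP=> x; rewrite !inE => /andP[xu /orP[/eqP E|/andP[_ ->]]].
      by rewrite E iu in xu.
    by rewrite xu.
  exists l; rewrite !inE ?lu ?lv // eqxx orbF /=.
  by apply/negP=> /eqP E; rewrite -E lv in iv.
have [||||w [wN wu cw]] := IH (i |: (v :\ l)).
- by apply: leq_trans (proper_card sub) _.
- exact: hN.
- by rewrite card_swap.
- by move=> x /(subsetP (proper_sub sub)) /hv.
by exists w; split=> //; rewrite cw card_swap.
Qed.

(** The variables that generate the successive colon ideals. *)
Definition lower_gaps u := [set k : 'I_n | k < set_top u] :\: u.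

Lemma card_lower_gaps u : #|lower_gaps u| = #|[set k : 'I_n | k < set_top u]| - #|u|.
Proof.
rewrite cardsD (setIidPr _) //.
by apply/subsetP=> k ku; rewrite inE ltn_set_top.
Qed.

(** An encoding of the lexicographic order on (size, largest vertex): the second
    component is smaller than the base n.+2. *)
Definition size_top_key u := #|u| * n.+2 + set_top u.

Lemma set_top_bound u : set_top u < n.+2.
Proof. by rewrite ltnS; apply: leqW; apply/set_top_leP=> i _; apply: ltn_ord. Qed.

Lemma size_top_key_ltl u v : #|u| < #|v| -> size_top_key u < size_top_key v.
Proof.
move=> h; apply: (@leq_trans (#|u|.+1 * n.+2)).
  by rewrite /size_top_key mulSn addnC ltn_add2r set_top_bound.
by apply: leq_trans (leq_addr _ _); rewrite leq_mul2r h orbT.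
Qed.

Lemma size_top_key_card u v : size_top_key u <= size_top_key v -> #|u| <= #|v|.
Proof. by rewrite leqNgt => h; rewrite leqNgt; apply: contra h; apply: size_top_key_ltl. Qed.

Lemma size_top_key_top u v : #|u| = #|v| ->
  (size_top_key u <= size_top_key v) = (set_top u <= set_top v).
Proof. by rewrite /size_top_key => ->; rewrite leq_add2l. Qed.

Definition sorted_min_sets N :=
  sort (fun u v => size_top_key u <= size_top_key v) (enum (min_sets N)).

Lemma mem_sorted_min_sets N : sorted_min_sets N =i min_sets N.
Proof. by move=> u; rewrite mem_sort mem_enum. Qed.

(** [has (fun v => v \subset X :|: u) s1] says that x_u times a monomial with
    support X lies in the ideal of the earlier generators, so the second part
    computes the colon ideal.  A gap k of u gives the member (u \ m(u)) + k,
    above which sits a minimal generator that comes earlier.  Conversely, if an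
    earlier v contained no gap of u, then all of v \ u would lie above u and
    [stable_exchange] would give a member of size |v| inside u; minimality of u
    forces |v| = |u|, but then v has the larger largest vertex and comes
    later. *)
Lemma stable_linear_quotients N (s1 s2 : seq {set 'I_n}) u :
  up_closed N -> stable_family N -> sorted_min_sets N = s1 ++ u :: s2 ->
  {in s1, forall v, #|v| <= #|u|} /\
  forall X, has (fun v => v \subset X :|: u) s1 = (X :&: lower_gaps u != set0).
Proof.
move=> hup hst E.
have uG : u \in min_sets N by rewrite -mem_sorted_min_sets E mem_cat inE eqxx orbT.
have /(min_setsP _ hup) [uN umin] := uG.
have uniqs : uniq (sorted_min_sets N) by rewrite sort_uniq enum_uniq.
have us1 : u \notin s1.
  by move: uniqs; rewrite E cat_uniq => /and3P[_ /hasPn/(_ u) h _]; apply: h; rewrite inE eqxx.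
have : pairwise (fun u v => size_top_key u <= size_top_key v) (sorted_min_sets N).
  rewrite -sorted_pairwise; first by apply: sort_sorted => x y; apply: leq_total.
  by move=> x y z; apply: leq_trans.
rewrite E pairwise_cat => /and3P[/allrelP rel _ /= /andP[/allP rel2 _]].
have before v : v \in s1 -> size_top_key v <= size_top_key u.
  by move=> vs1; apply: rel => //; rewrite inE eqxx.
have after v : v \in min_sets N -> size_top_key v < size_top_key u -> v \in s1.
  rewrite -mem_sorted_min_sets E mem_cat inE => /or3P[//|/eqP->|/rel2].
    by rewrite ltnn.
  by rewrite leqNgt => /negbTE->.
split=> [v /before|X]; first exact: size_top_key_card.
apply/hasP/set0Pn => [[v vs1 vXu]|[k]].
  have vG : v \in min_sets N by rewrite -mem_sorted_min_sets E mem_cat vs1.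
  have /(min_setsP _ hup) [vN _] := vG.
  apply/set0Pn; apply: contraNneq us1 => X0.
  have htop : {in v :\: u, forall k, set_top u <= k}.
    move=> k; rewrite inE => /andP[ku kv]; rewrite leqNgt; apply/negP=> hk.
    have kX : k \in X by move: (subsetP vXu k kv); rewrite inE (negbTE ku) orbF.
    have : k \in X :&: lower_gaps u; last by rewrite X0 inE.
    by rewrite !inE kX ku.
  have [w [wN wu cw]] := stable_exchange hst vN (size_top_key_card (before v vs1)) htop.
  have Ewu := umin w wN wu; rewrite Ewu in cw.
  have := before v vs1; rewrite size_top_key_top // => tvu.
  rewrite -(umin v vN) // -setD_eq0; apply/set0Pn=> -[k kvu].
  move: (kvu); rewrite inE => /andP[_ /ltn_set_top hk].
  by have := leq_trans hk (leq_trans tvu (htop k kvu)); rewrite ltnn.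
rewrite !inE => /and3P[kX ku hk].
have [i iu] : exists i, i \in u.
  by apply/set0Pn; apply: contraTneq hk => ->; rewrite /set_top big_set0.
have [l lu El] := set_top_max iu.
have {}hk : k < l.
  rewrite El ltnS leq_eqVlt in hk; case/orP: hk => // /eqP/val_inj E'.
  by rewrite E' lu in ku.
have [v vG vsub] := min_sets_below (hst u l k uN lu El hk ku).
have vXu : v \subset X :|: u.
  apply: subset_trans vsub _; rewrite subUset sub1set inE kX /=.
  by apply: subset_trans (subD1set _ _) (subsetUr _ _).
exists v => //; apply: after => //.
have := subset_leq_card vsub; rewrite card_swap // leq_eqVlt => /orP[/eqP cv|]; last first.
  exact: size_top_key_ltl.
have -> : v = k |: (u :\ l) by apply/eqP; rewrite eqEcard vsub card_swap // cv /= leqnn.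
rewrite ltnNge size_top_key_top; last by rewrite card_swap.
rewrite -ltnNge El ltnS.
apply/set_top_leP=> x; rewrite !inE => /orP[/eqP->//|/andP[xl /ltn_set_top]].
by rewrite El ltnS leq_eqVlt => /orP[/eqP/val_inj E'|//]; rewrite E' eqxx in xl.
Qed.

End StableFamilies.

(** * Counting members by size and largest vertex; combinatorial shifts *)

Section Counting.
Variables (n : nat).
Implicit Types (N : {set {set 'I_n}}) (s t u v w X : {set 'I_n}) (i j k l : 'I_n).

(** If removing some vertex x leaves a member, stability replaces the largest
    vertex l of that member by x, so that removing l leaves a member too. *)
Lemma min_sets_stable N s l : up_closed N -> stable_family N -> s \in N ->
  l \in s -> set_top s = l.+1 -> (s \in min_sets N) = (s :\ l \notin N).
Proof.
move=> hup hst sN ls El; rewrite inE sN /=.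
apply/forall_inP/idP => [/(_ l ls)//|h x xs].
have [->//|xl] := eqVneq x l.
apply: contra h => sxN.
have ltx : x < l by have := ltn_set_top xs; rewrite El ltnS ltn_neqAle xl.
have -> : s :\ l = x |: ((s :\ x) :\ l).
  apply/setP=> y; rewrite !inE; case: (eqVneq y x) => [->|]; rewrite ?xl ?xs //.
apply: (hst _ _ _ sxN); rewrite ?inE ?eqxx // 1?eq_sym ?xl //.
apply: set_top_eq; first by rewrite !inE eq_sym xl.
by move=> y; rewrite !inE => /andP[_ /ltn_set_top]; rewrite El ltnS.
Qed.

(** The second sum runs over the members that are not minimal, each written
    uniquely as t + l with l above t.  As its inner sum is again a function of
    the size and largest vertex of t, the minimal members are counted by data of
    the whole family. *)
Lemma sum_min_sets N (f : nat -> nat -> nat) : up_closed N -> stable_family N ->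
  \sum_(s in min_sets N) f #|s| (set_top s) +
    \sum_(t in N) \sum_(l : 'I_n | set_top t <= l) f #|t|.+1 l.+1
  = \sum_(s in N) f #|s| (set_top s).
Proof.
move=> hup hst; rewrite [RHS](bigID (mem (min_sets N))) /=; congr (_ + _).
  by apply: eq_bigl => s; rewrite andb_idl // inE => /andP[].
rewrite (exchange_big_dep xpredT) //=.
rewrite [RHS](eq_bigr (fun s => \sum_(l : 'I_n | (l \in s) && (set_top s == l.+1)) f #|s| l.+1)).
  rewrite [RHS](exchange_big_dep xpredT) //=; apply: eq_bigr => l _.
  rewrite [RHS](reindex_onto (fun t => l |: t) (fun s => s :\ l)) /=; last first.
    by move=> s /andP[_ /andP[ls _]]; rewrite setD1K.
  apply: eq_big => [t|t /andP[tN tl]]; last first.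
    have lt : l \notin t by apply: contraTN tl => /ltn_set_top; rewrite ltnNge.
    by rewrite cardsU1 lt.
  apply/andP/andP => [[tN tl]|[/andP[/andP[ltN ltG] /andP[_ /eqP El]] /eqP E]].
    have lt : l \notin t by apply: contraTN tl => /ltn_set_top; rewrite ltnNge.
    have E : (l |: t) :\ l = t by rewrite setU1K.
    have El : set_top (l |: t) = l.+1.
      apply: set_top_eq; first by rewrite setU11.
      move=> k; rewrite !inE => /orP[/eqP->//|/ltn_set_top h].
      exact: ltnW (leq_trans h tl).
    have ltN : l |: t \in N by apply: hup tN _; apply: subsetUr.
    by rewrite (min_sets_stable hup hst ltN (setU11 _ _) El) ltN E tN El setU11 !eqxx.
  move: ltG; rewrite (min_sets_stable hup hst ltN (setU11 _ _) El) E negbK => ->.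
  split=> //; apply/set_top_leP=> k kt; rewrite ltn_neqAle -ltnS -El ltn_set_top ?setU1r // andbT.
  by apply/eqP=> /val_inj E'; move/setP/(_ l): E; rewrite !inE eqxx -E' kt.
move=> s /andP[sN sG].
have [s0|[i si]] := set_0Vmem s.
  case/negP: sG; apply/(min_setsP _ hup); split=> // t _.
  by rewrite s0 subset0 => /eqP.
have [l ls El] := set_top_max si.
rewrite (bigD1 l) /=; last by rewrite ls El eqxx.
rewrite El big1 ?addn0 // => k /andP[/andP[_ /eqP[E]] /eqP]; case.
exact/val_inj.
Qed.

(** The image of N under S_ab, described by membership; [shift_nonfacesP] and
    [mem_shift_fun] relate it to the map. *)
Definition shift_nonfaces N (a b : 'I_n) : {set {set 'I_n}} :=
  [set s : {set 'I_n} | if a \in s then (s \in N) || (b \notin s) && (b |: (s :\ a) \in N)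
           else (s \in N) && ((b \in s) ==> (a |: (s :\ b) \in N))].

Lemma subset_swap s t i l : s \subset t -> i |: (s :\ l) \subset i |: (t :\ l).
Proof. by move=> st; apply: setUS; apply: setSD. Qed.

Lemma shift_nonfaces_up N a b : up_closed N -> a != b ->
  up_closed (shift_nonfaces N a b).
Proof.
move=> hN ab s t; rewrite !inE => + st.
have mono x : x \in s -> x \in t := subsetP st x.
case: ifP => as_.
  rewrite (mono _ as_) => /orP[sN|/andP[bs bN]].
    by rewrite (hN _ _ sN st).
  case: (boolP (b \in t)) => bt /=; last first.
    by rewrite (hN _ _ bN (subset_swap b a st)) orbT.
  rewrite (hN _ _ bN) // subUset sub1set bt.
  by apply: subset_trans (subD1set _ _) st.
case/andP=> sN /implyP bS; rewrite (hN _ _ sN st) /=.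
case: ifP => // at_; apply/implyP => bt.
case: (boolP (b \in s)) => bs; first exact: hN (bS bs) (subset_swap a b st).
apply: hN sN _; apply/subsetP=> x xs; rewrite !inE (mono _ xs) andbT.
by case: eqP => //= _; apply: contraNneq bs => <-.
Qed.

Definition shift_fun N (a b : 'I_n) s :=
  if [&& b \in s, a \notin s & a |: (s :\ b) \notin N] then a |: (s :\ b) else s.

Lemma swap_swap (a b : 'I_n) s : b \in s -> a \notin s -> b |: ((a |: (s :\ b)) :\ a) = s.
Proof.
by move=> bs as_; rewrite setU1K ?setD1K // !inE negb_and as_ orbT.
Qed.

Lemma mem_shift_fun N a b s : a != b -> s \in N -> shift_fun N a b s \in shift_nonfaces N a b.
Proof.
move=> ab sN; rewrite /shift_fun; case: ifP => [/and3P[bs as_ sw]|].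
  rewrite inE setU11 swap_swap // sN andbT; apply/orP; right.
  by rewrite !inE eqxx eq_sym (negbTE ab).
rewrite inE sN /= => /negbT; rewrite !negb_and !negbK.
by case: (a \in s) => //=; case: (b \in s).
Qed.

Lemma shift_nonfacesP N a b s : a != b -> s \in shift_nonfaces N a b ->
  exists2 t, t \in N & shift_fun N a b t = s.
Proof.
move=> ab sS; have [sN|sN] := boolP (s \in N).
  exists s => //; rewrite /shift_fun; case: ifP => // /and3P[bs as_ sw].
  by move: sS; rewrite inE (negbTE as_) bs (negbTE sw) andbF.
move: sS; rewrite inE (negbTE sN) /=; case: ifP => // as_ /andP[bs bN].
exists (b |: (s :\ a)) => //; rewrite /shift_fun.
by rewrite setU11 swap_swap // sN !inE eqxx (negbTE ab) ?andbF.
Qed.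

Lemma shift_fun_inj N a b : a != b -> {in N &, injective (shift_fun N a b)}.
Proof.
move=> ab s t sN tN; rewrite /shift_fun.
case: ifP => [/and3P[bs as_ sw]|_]; case: ifP => [/and3P[bt at_ tw]|_] E //.
- by rewrite -(swap_swap bs as_) E swap_swap.
- by rewrite E tN in sw.
- by rewrite -E sN in tw.
Qed.

Lemma card_shift_fun N a b s : #|shift_fun N a b s| = #|s|.
Proof. by rewrite /shift_fun; case: ifP => // /and3P[bs as_ _]; rewrite card_swap. Qed.

(** If b is the largest vertex of s, stability of N already contains the
    swapped set, so s stays put; otherwise the largest vertex is untouched. *)
Lemma top_shift_fun N (a b : 'I_n) s : stable_family N -> a < b -> s \in N ->
  set_top (shift_fun N a b s) = set_top s.
Proof.
move=> hst ab sN; rewrite /shift_fun; case: ifP => // /and3P[bs as_ sw].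
have [l ls El] := set_top_max bs.
have bl : b != l.
  by apply: contraNneq sw => E; apply: hst => //; rewrite El E.
have ltbl : b < l by have := ltn_set_top bs; rewrite El ltnS ltn_neqAle bl.
rewrite El; apply: set_top_eq; first by rewrite !inE ls (eq_sym l) bl orbT.
move=> k; rewrite !inE => /orP[/eqP->|/andP[_ /ltn_set_top]].
  exact: ltnW (ltn_trans ab ltbl).
by rewrite El ltnS.
Qed.

Lemma sum_shift_nonfaces N (a b : 'I_n) (f : nat -> nat -> nat) :
  stable_family N -> a < b ->
  \sum_(s in shift_nonfaces N a b) f #|s| (set_top s) = \sum_(s in N) f #|s| (set_top s).
Proof.
move=> hst ab; have ab' : a != b by rewrite -val_eqE neq_ltn ab.
have -> : shift_nonfaces N a b = [set shift_fun N a b s | s in N].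
  apply/setP=> s; apply/idP/imsetP => [/(shift_nonfacesP ab')[t tN <-]|[t tN ->]].
    by exists t.
  exact: mem_shift_fun.
rewrite big_imset; last exact: shift_fun_inj.
by apply: eq_bigr => s sN; rewrite card_shift_fun top_shift_fun.
Qed.

Lemma set_top_swap s i x l : l \in s -> set_top s = l.+1 -> l != x -> i <= l ->
  set_top (i |: (s :\ x)) = l.+1.
Proof.
move=> ls El lx il; apply: set_top_eq; first by rewrite !inE lx ls orbT.
by move=> k; rewrite !inE => /orP[/eqP->//|/andP[_ /ltn_set_top]]; rewrite El ltnS.
Qed.

Lemma swapAC s i j k l : i != j -> i != k -> j != l -> k != l ->
  i |: ((j |: (s :\ k)) :\ l) = j |: ((i |: (s :\ l)) :\ k).
Proof.
move=> ij ik jl kl; apply/setP=> y; rewrite !inE.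
case: (eqVneq y i) => [->|yi] /=; first by rewrite ik orbT.
by case: (eqVneq y j) => [->|yj] /=; rewrite ?jl // andbCA.
Qed.

(** A case analysis on how {l, i} meets {a, b}: each member that witnesses
    s in the shifted family is moved by stability of N, and the resulting
    swaps commute. *)
Lemma stable_shift N (a b : 'I_n) : stable_family N -> a < b ->
  stable_family (shift_nonfaces N a b).
Proof.
move=> hst ab s l i sS ls El il is_.
have abn : a != b by rewrite -val_eqE neq_ltn ab.
have lin : l != i by rewrite -val_eqE neq_ltn il orbT.
have top k : k \in s -> k != l -> k < l.
  by move=> /ltn_set_top; rewrite El ltnS ltn_neqAle => -> ->.
have notin k : l < k -> k \notin s.
  by move=> lk; apply: contraTN lk => /ltn_set_top; rewrite El ltnS -leqNgt.
have stN j : s \in N -> j < l -> j \notin s -> j |: (s :\ l) \in N by move=> sN; apply: hst.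
(* Once b lies above all of s, it is the largest vertex of (s \ a) + b, so
   stability trades it back for a. *)
have back : l < b -> a \in s -> b |: (s :\ a) \in N -> s \in N.
  move=> lb as_ h; have bs := notin b lb.
  rewrite -(swap_swap as_ bs); apply: hst => //; rewrite ?setU11 //.
    apply: set_top_eq; first exact: setU11.
    move=> k; rewrite !inE => /orP[/eqP->//|/andP[_ /ltn_set_top]].
    by rewrite El ltnS => kl; apply: ltnW (leq_ltn_trans kl lb).
  by rewrite !inE eqxx (negbTE abn).
have mem k : k != l -> k != i -> (k \in i |: (s :\ l)) = (k \in s).
  by move=> kl ki; rewrite !inE kl (negbTE ki).
have lnot : l \notin i |: (s :\ l) by rewrite !inE eqxx (negbTE lin).
have [Elb|lb] := eqVneq l b.
  have sN : s \in N.
    by move: sS; rewrite inE -Elb ls /=; case: ifP => _; [rewrite orbF|case/andP].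
  by rewrite inE -Elb (negbTE lnot) (stN i) //=; case: ifP.
have [Ela|la] := eqVneq l a.
  have lb' : l < b by rewrite Ela.
  have sN : s \in N.
    move: sS; rewrite inE -Ela ls => /orP[//|/andP[_]]; rewrite Ela.
    by apply: back => //; rewrite -Ela.
  rewrite inE -Ela (negbTE lnot) (stN i) //= mem 1?eq_sym //; last first.
    by rewrite -val_eqE neq_ltn (ltn_trans il lb').
  by rewrite (negbTE (notin b lb')).
have [Eia|ia] := eqVneq i a.
  rewrite inE -{1}Eia setU11 (stN i) //.
  by move: sS; rewrite inE -Eia (negbTE is_) => /andP[].
have [Eib|ib] := eqVneq i b.
  have al : a < l by rewrite (ltn_trans ab) // -Eib.
  rewrite inE mem 1?eq_sym // -Eib setU11 /=; move: sS; rewrite inE -Eib (negbTE is_) /=.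
  have [as_|as_] := boolP (a \in s); rewrite ?orbF ?andbT.
    case/orP=> [/stN-> //|h].
    have al' : a \notin i |: (s :\ a) by rewrite !inE eqxx Eib (negbTE abn).
    suff -> : i |: (s :\ l) = a |: ((i |: (s :\ a)) :\ l).
      apply: (hst _ _ _ h) => //; first by rewrite !inE la ls orbT.
      by apply: set_top_swap => //; apply: ltnW.
    apply/setP=> y; rewrite !inE; case: (eqVneq y a) => [->|_] /=.
      by rewrite as_ (eq_sym a l) la orbT.
    by case: (eqVneq y i) => [->|_] //=; rewrite eq_sym lin.
  move=> sN; rewrite (stN i) //= setU1K ?stN //.
  by rewrite !inE (negbTE is_) andbF.
rewrite inE !mem 1?eq_sym //; move: sS; rewrite inE.
have [as_|as_] := boolP (a \in s).
  case/orP=> [/stN->//|/andP[bs h]].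
  rewrite bs /=; case: (ltngtP b l) => [bl|lb'|/val_inj E].
  - apply/orP; right; rewrite -swapAC //; try by rewrite eq_sym.
    apply: (hst _ _ _ h) => //.
    + by rewrite !inE la ls orbT.
    + by apply: set_top_swap => //; apply: ltnW.
    + by rewrite !inE negb_or ib negb_and is_ orbT.
  - by rewrite (stN i) // back.
  - by rewrite E eqxx in lb.
case/andP=> sN /implyP h; rewrite (stN i) //=; apply/implyP => bs.
have bl : b < l by apply: top; rewrite // eq_sym.
rewrite -swapAC //; try by rewrite eq_sym.
apply: (hst _ _ _ (h bs)) => //.
- by rewrite !inE lb ls orbT.
- by apply: set_top_swap => //; apply: ltnW (ltn_trans ab bl).
- by rewrite !inE negb_or ia negb_and is_ orbT.
Qed.
End Counting.

Local Open Scope ring_scope.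

(** * Graded matrices over a polynomial ring *)

Section GradedMatrices.
Variables (K : fieldType) (n : nat).
Implicit Types (p q : {mpoly K[n]}) (m : 'X_{1..n}).

(** p is an entry of a degree 0 map from S(-e) to S(-b).  Stated on the support,
    the zero polynomial qualifies without the constraint b <= e. *)
Definition twist_homog (e b : nat) p :=
  forall m, m \in msupp p -> (mdeg m + b)%N = e.

Definition graded r s (ea : 'I_r -> nat) (eb : 'I_s -> nat)
    (M : 'M[{mpoly K[n]}]_(r, s)) :=
  forall a b, twist_homog (ea a) (eb b) (M a b).

Lemma twist_homogP e b p :
  twist_homog e b p <->
  p = 0 \/ (b <= e)%N /\ p \is (e - b).-homog.
Proof.
split=> [h|[->|[le_be /dhomogP h]] m]; last first.
- by move/h=> ->; rewrite subnK.
- by rewrite msupp0.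
have [->|p0] := eqVneq p 0; first by left.
right; have hm m : m \in msupp p -> (b <= e)%N by move/h=> <-; rewrite leq_addl.
have le_be : (b <= e)%N.
  by move: p0; rewrite -msupp_eq0; case E: (msupp p) => [//|m s] _;
     apply: (hm m); rewrite E inE eqxx.
by split=> //; apply/dhomogP=> m /h <-; rewrite addnK.
Qed.

Lemma twist_homog0 e b : twist_homog e b 0.
Proof. by move=> m; rewrite msupp0. Qed.

Lemma twist_homogN e b p : twist_homog e b p -> twist_homog e b (- p).
Proof. by move=> h m; rewrite (perm_mem (msuppN p)); apply: h. Qed.

Lemma twist_homog_sum (I : finType) e b (F : I -> {mpoly K[n]}) :
  (forall i, twist_homog e b (F i)) -> twist_homog e b (\sum_i F i).
Proof.
move=> h; apply: (big_ind (twist_homog e b)) => //.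
- exact: twist_homog0.
- move=> p q hp hq m /msuppD_le; rewrite mem_cat => /orP[]; [exact: hp|exact: hq].
Qed.

Lemma twist_homogM e a b p q :
  twist_homog e a p -> twist_homog a b q -> twist_homog e b (p * q).
Proof.
move=> hp hq m /msuppM_le/allpairsP[[m1 m2] /= [/hp <- /hq <- ->]].
by rewrite mdegD addnA.
Qed.

Lemma gradedM r s t (ea : 'I_r -> nat) (eb : 'I_s -> nat) (ec : 'I_t -> nat)
    (M : 'M_(r, s)) (N : 'M_(s, t)) :
  graded ea eb M -> graded eb ec N -> graded ea ec (M *m N).
Proof.
move=> hM hN a c; rewrite mxE; apply: twist_homog_sum => b.
exact: twist_homogM (hM a b) (hN b c).
Qed.

Definition mono_part (P : pred 'X_{1..n}) p :=
  \sum_(m <- msupp p | P m) p@_m *: 'X_[K, m].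

Lemma mcoeff_mono_part (P : pred 'X_{1..n}) p m :
  (mono_part P p)@_m = if P m then p@_m else 0.
Proof.
rewrite /mono_part [LHS]raddf_sum /=.
rewrite (eq_bigr (fun m' => if m' == m then p@_m else 0)); last first.
  by move=> m' _; rewrite mcoeffZ mcoeffX; case: eqP => [->|];
     rewrite ?mulr1 ?mulr0.
rewrite -big_mkcondr.
have [hm|hm] := boolP (m \in msupp p); last first.
  move: hm; rewrite -mcoeff_eq0 => /eqP->.
  by rewrite big1_eq; case: ifP.
case: ifP => hd.
  rewrite (big_rem m) //= hd ?eqxx /= big1_seq ?addr0 // => m' /andP[/andP[_ /eqP->]].
  by rewrite mem_rem_uniq ?msupp_uniq // !inE eqxx.
by rewrite big1 // => m' /andP[hd' /eqP E]; rewrite E hd in hd'.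
Qed.

Definition twist_part (e b : nat) p :=
  mono_part (fun m => (mdeg m + b == e)%N) p.

Lemma mcoeff_twist_part e b p m :
  (twist_part e b p)@_m = if (mdeg m + b == e)%N then p@_m else 0.
Proof. exact: mcoeff_mono_part. Qed.

Lemma twist_part_homog e b p : twist_homog e b (twist_part e b p).
Proof.
move=> m; rewrite mcoeff_msupp mcoeff_twist_part.
by case: (mdeg m + b =P e)%N => // _; rewrite eqxx.
Qed.

Lemma mcoeff_twist_partM e a b p q m : twist_homog a b q ->
  (twist_part e a p * q)@_m = if (mdeg m + b == e)%N then (p * q)@_m else 0.
Proof.
move=> hq; rewrite !mcoeffM.
have -> : (if (mdeg m + b == e)%N then
   \sum_(k : 'X_{1..n < (mdeg m).+1, (mdeg m).+1} | m == (k.1 + k.2)%MM)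
      (p@_k.1 * q@_k.2) else 0) =
   \sum_(k : 'X_{1..n < (mdeg m).+1, (mdeg m).+1} | m == (k.1 + k.2)%MM)
      (if (mdeg m + b == e)%N then p@_k.1 * q@_k.2 else 0).
  by case: ifP => // _; rewrite big1.
apply: eq_bigr => k /eqP E; rewrite mcoeff_twist_part.
have [hk|] := boolP (val k.2 \in msupp q); last first.
  by rewrite -mcoeff_eq0 => /eqP->; rewrite !mulr0; case: ifP.
have -> : (mdeg m + b = mdeg k.1 + (mdeg (val k.2) + b))%N.
  by rewrite addnA -mdegD; congr (mdeg _ + _)%N.
by rewrite (hq _ hk); case: ifP; rewrite ?mul0r.
Qed.

(** A factorization of a graded matrix can be made graded by keeping only the
    component of the right degree in each entry. *)
Lemma graded_factor r s t (ea : 'I_r -> nat) (eb : 'I_s -> nat)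
    (ec : 'I_t -> nat) (M : 'M_(r, s)) (W : 'M_(r, t)) (B : 'M_(t, s)) :
  graded ea eb M -> graded ec eb B -> M = W *m B ->
  exists2 W', graded ea ec W' & M = W' *m B.
Proof.
move=> hM hB E; exists (\matrix_(a, c) twist_part (ea a) (ec c) (W a c)).
  by move=> a c; rewrite mxE; apply: twist_part_homog.
apply/matrixP=> a b; rewrite mxE; apply/mpolyP=> m; rewrite [RHS]raddf_sum /=.
rewrite (eq_bigr (fun c => if (mdeg m + eb b == ea a)%N then (W a c * B c b)@_m else 0));
  last by move=> c _; rewrite mxE; apply: mcoeff_twist_partM.
case: ((mdeg m + eb b)%N =P ea a) => hm; first by rewrite E mxE; exact: (raddf_sum (mcoeff m)).
rewrite big1 //; apply/eqP; rewrite mcoeff_eq0; apply/negP=> /hM h.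
exact: hm h.
Qed.

Lemma row_factor r s t (M : 'M[{mpoly K[n]}]_(r, s)) (B : 'M_(t, s)) :
  (forall i, exists w, row i M = w *m B) -> exists W, M = W *m B.
Proof.
move/fin_all_exists=> [w hw]; exists (\matrix_i w i).
by apply/row_matrixP=> i; rewrite row_mul rowK.
Qed.

Definition const_term r s (M : 'M[{mpoly K[n]}]_(r, s)) : 'M[K]_(r, s) :=
  map_mx (mcoeff 0%MM) M.

Lemma const_termM r s t (M : 'M_(r, s)) (N : 'M_(s, t)) :
  const_term (M *m N) = const_term M *m const_term N.
Proof. exact: map_mxM. Qed.

Lemma const_term_graded r s (ea : 'I_r -> nat) (eb : 'I_s -> nat) M a b :
  graded ea eb M -> const_term M a b != 0 -> ea a = eb b.
Proof.
by move=> hM; rewrite mxE -mcoeff_msupp => /hM; rewrite mdeg0.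
Qed.

End GradedMatrices.

(** Dependent choice, for building chain maps degree by degree: P is the
    induction invariant and R the relation between consecutive terms. *)
Lemma dependent_choice_seq (T : nat -> Type) (P : forall i, T i -> Prop)
    (R : forall i, T i -> T i.+1 -> Prop) (Q : T 0%N -> Prop) :
  (exists x, P 0%N x /\ Q x) ->
  (forall i x, P i x -> exists y, P i.+1 y /\ R i x y) ->
  exists f : forall i, T i,
    [/\ Q (f 0%N), forall i, P i (f i) & forall i, R i (f i) (f i.+1)].
Proof.
move=> h0 hS.
have {h0} [x0 [Px0 Qx0]] := constructive_indefinite_description _ h0.
pose next i (x : {x : T i | P i x}) : {x : T i.+1 | P i.+1 x} :=
  let s := constructive_indefinite_description _ (hS i _ (svalP x)) in
  exist _ (sval s) (svalP s).1.
pose f := nat_rect (fun i => {x : T i | P i x}) (exist _ x0 Px0) next.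
exists (fun i => sval (f i)); split=> // i; first exact: (svalP (f i)).
exact: (svalP (constructive_indefinite_description _ (hS i _ (svalP (f i))))).2.
Qed.

(** * Comparison of resolutions and mapping cones *)

Section Resolutions.
Variables (K : fieldType) (n : nat).
Implicit Types (F G : free_complex K n) (I J : {mpoly K[n]} -> Prop).

(** The complex augmented by S in degree 0, so that the augmentation and the
    differentials, and likewise aug_exact and diff_exact, are treated alike. *)
Definition augm_rank F i := if i is i'.+1 then res_rank F i' else 1%N.

Definition augm_deg F i : 'I_(augm_rank F i) -> nat :=
  match i return 'I_(augm_rank F i) -> nat with
  | 0%N => fun=> 0%N
  | i'.+1 => @res_deg K n F i'
  end.

Definition augm_diff F i : 'M[{mpoly K[n]}]_(augm_rank F i.+1, augm_rank F i) :=
  match i return 'M_(augm_rank F i.+1, augm_rank F i) with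
  | 0%N => res_aug F
  | i'.+1 => res_diff F i'
  end.

Lemma augm_diff_graded I F i : minimal_graded_resolution I F ->
  graded (@augm_deg F i.+1) (@augm_deg F i) (augm_diff F i).
Proof.
case=> hA hD _ _ _ _; case: i => [|i] a b; apply/twist_homogP.
  by right; split=> //; rewrite subn0 /= (ord1 b).
exact: (hD i a b).
Qed.

Lemma augm_diff_exact_row I F i (v : 'rV_(augm_rank F i.+1)) :
  minimal_graded_resolution I F ->
  v *m augm_diff F i = 0 <-> exists w, v = w *m augm_diff F i.+1.
Proof. by case=> _ _ _ hA hD _; case: i v => [|i] v; [exact: hA|exact: hD]. Qed.

Lemma augm_diff_comp I F i : minimal_graded_resolution I F ->
  augm_diff F i.+1 *m augm_diff F i = 0.
Proof.
move=> hF; apply/row_matrixP=> a; rewrite row_mul row0.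
by apply/(augm_diff_exact_row _ hF); exists (delta_mx 0 a); rewrite rowE.
Qed.

Lemma augm_diff_exact I F i r (M : 'M_(r, augm_rank F i.+1)) :
  minimal_graded_resolution I F ->
  M *m augm_diff F i = 0 -> exists W, M = W *m augm_diff F i.+1.
Proof.
move=> hF M0; apply: row_factor => a.
by apply/(augm_diff_exact_row _ hF); rewrite -row_mul M0 row0.
Qed.

(** Multiplication by u maps I into J, so it lifts to the resolutions.  The
    invariant is that the next square can be filled; it is kept because
    consecutive differentials compose to 0. *)
Lemma chain_lift I J F G d (u : {mpoly K[n]}) :
  minimal_graded_resolution I F -> minimal_graded_resolution J G ->
  u \is d.-homog -> (forall p, I p -> J (p * u)) ->
  exists phi : forall i, 'M[{mpoly K[n]}]_(augm_rank F i, augm_rank G i),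
    [/\ phi 0%N = u%:M,
        forall i, graded (fun a => d + augm_deg a)%N (@augm_deg G i) (phi i)
      & forall i, augm_diff F i *m phi i = phi i.+1 *m augm_diff G i].
Proof.
move=> hF hG /dhomogP hu hIJ.
have [] := (@dependent_choice_seq (fun i => 'M[{mpoly K[n]}]_(augm_rank F i, augm_rank G i))
  (fun i x => graded (fun a => d + augm_deg a)%N (@augm_deg G i) x /\
     exists w, augm_diff F i *m x = w *m augm_diff G i)
  (fun i x y => augm_diff F i *m x = y *m augm_diff G i)
  (fun x => x = u%:M)); last first.
- by move=> phi [Q gP R]; exists phi; split=> // i; case: (gP i).
- move=> i x [gx [w hw]].
have gM : graded (fun a => d + augm_deg a)%N (@augm_deg G i) (augm_diff F i *m x).
  apply: gradedM gx => a b m /(augm_diff_graded hF) <-.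
  by rewrite addnCA addnA.
have [W gW hW] := graded_factor gM (augm_diff_graded (i := i) hG) hw.
exists W; split=> //; split=> //; apply: (augm_diff_exact hG).
by rewrite -mulmxA -hW mulmxA (augm_diff_comp _ hF) mul0mx.
  exists u%:M; split=> //; split.
    move=> a b m; rewrite mxE (ord1 a) (ord1 b) eqxx mulr1n => /hu /=.
    by rewrite !addn0.
  apply: row_factor => a; rewrite row_mul mul_mx_scalar.
  have : J ((u *: row a (augm_diff F 0)) 0 0).
    rewrite mxE mulrC; apply: hIJ; apply/(aug_image hF).
    by exists (delta_mx 0 a); rewrite -rowE.
  move/(aug_image hG) => [v hv]; exists v.
  by apply/matrixP=> b c; rewrite (ord1 b) (ord1 c).
Qed.

Lemma const_term_diff I F i : minimal_graded_resolution I F ->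
  const_term (res_diff F i) = 0.
Proof. by case=> _ _ _ _ _ hm; apply/matrixP=> a b; rewrite !mxE hm. Qed.

(** A chain map chi over the identity is homotopic to the identity, and by minimality the homotopy
    terms have no constant part.  Only one step h of the homotopy has to be
    remembered at a time; e is the contribution of the step before it.  The last
    condition starts with h = 0 because the augmentation itself may have a
    constant entry, when I is the unit ideal. *)
Lemma const_term_endo I F (chi : forall i, 'M_(augm_rank F i)) :
  minimal_graded_resolution I F -> chi 0%N = 1%:M ->
  (forall i, augm_diff F i *m chi i = chi i.+1 *m augm_diff F i) ->
  forall i, const_term (chi i) = 1%:M.
Proof.
move=> hF chi0 chiS.
have key i : exists h e, [/\ chi i = 1%:M + e + h *m augm_diff F i,
    augm_diff F i *m e = 0, const_term e = 0 & const_term (augm_diff F i *m h) = 0].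
  elim: i => [|i [h [e [E de ce ch]]]].
    exists 0, 0; rewrite chi0 mul0mx !mulmx0 !addr0.
    by split=> //; apply: raddf0.
  (* The defect is a cycle, hence a boundary, which is the next homotopy step. *)
  have [] := augm_diff_exact (i := i) (M := chi i.+1 - 1%:M - augm_diff F i *m h) hF.
    rewrite !mulmxBl mul1mx -chiS E !mulmxDr mulmx1 de addr0 mulmxA.
    by rewrite addrAC addrK subrr.
  move=> h' E'; exists h', (augm_diff F i *m h); split.
  - by rewrite -E' [RHS]addrC [X in _ = _ + X]addrC addrA !subrK.
  - by rewrite mulmxA (augm_diff_comp _ hF) mul0mx.
  - exact: ch.
  by rewrite const_termM (const_term_diff _ hF) mul0mx.
case=> [|i]; first by rewrite chi0; exact: map_mx1.
have [h [e [-> _ ce _]]] := key i.+1.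
rewrite -[X in _ = X]addr0 -[X in _ = X]addr0 /const_term !map_mxD map_mx1.
by congr (_ + _ + _) => //; rewrite -/(const_term _) const_termM (const_term_diff _ hF) mulmx0.
Qed.

Definition betti F i j := #|[set a : 'I_(res_rank F i) | res_deg a == j]|.

(** Constant terms of the comparison maps are invertible and only connect basis
    vectors of the same degree, so they restrict to the basis vectors of
    degree j. *)
Lemma betti_le I F G i j :
  minimal_graded_resolution I F -> minimal_graded_resolution I G ->
  (betti F i j <= betti G i j)%N.
Proof.
move=> hF hG.
have h1 : (1 : {mpoly K[n]}) \is 0.-homog by apply: dhomog1.
have hI p : I p -> I (p * 1) by rewrite mulr1.
have [phi [phi0 gphi cphi]] := chain_lift hF hG h1 hI.
have [psi [psi0 gpsi cpsi]] := chain_lift hG hF h1 hI.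
have := const_term_endo (chi := fun i => phi i *m psi i) hF.
rewrite phi0 psi0 mulmx1 => h; have {}h := h erefl.
have E : const_term (phi i.+1) *m const_term (psi i.+1) = 1%:M.
  rewrite -const_termM; apply: h => k.
  by rewrite mulmxA cphi -mulmxA cpsi mulmxA.
set A := [set a : 'I_(res_rank F i) | res_deg a == j].
set B := [set a : 'I_(res_rank G i) | res_deg a == j].
rewrite /betti -/A -/B.
pose X := \matrix_(x < #|A|, y < #|B|)
  const_term (phi i.+1) (enum_val x : 'I_(augm_rank F i.+1)) (enum_val y : 'I_(augm_rank G i.+1)).
pose Y := \matrix_(y < #|B|, x < #|A|)
  const_term (psi i.+1) (enum_val y : 'I_(augm_rank G i.+1)) (enum_val x : 'I_(augm_rank F i.+1)).
apply: (mulmx1_min (A := X) (B := Y)); apply/matrixP=> x x'.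
have /matrixP/(_ (enum_val x) (enum_val x')) := E.
rewrite !mxE (inj_eq enum_val_inj) => <-.
(* Basis vectors of degree other than j do not contribute. *)
rewrite (bigID (mem B)) /= [X in _ = _ + X]big1 ?addr0; last first.
  move=> b; rewrite inE => hb.
  have [->|] := eqVneq (const_term (phi i.+1) (enum_val x) b) 0; first by rewrite mul0r.
  move/(const_term_graded (gphi i.+1)) => /= hd; move: hb.
  by rewrite -hd; have := enum_valP x; rewrite inE => /eqP->; rewrite eqxx.
by rewrite [RHS]big_enum_val; apply: eq_bigr => y _; rewrite !mxE.
Qed.

Lemma betti_unique I F G i j :
  minimal_graded_resolution I F -> minimal_graded_resolution I G ->
  betti F i j = betti G i j.
Proof. by move=> hF hG; apply/eqP; rewrite eqn_leq !(betti_le _ _ hF hG, betti_le _ _ hG hF). Qed.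

Lemma betti_sum F i j : betti F i j = (\sum_(a < res_rank F i) (res_deg a == j))%N.
Proof.
rewrite /betti -sum1_card big_mkcond; apply: eq_bigr => a _.
by rewrite inE; case: (res_deg a == j).
Qed.

Definition cone_rank F G i := (res_rank F i + augm_rank G i)%N.

(** G enters augmented: its term S in degree 0 is the new generator u, and its
    i-th term becomes a summand of the (i + 1)-st term of the cone. *)
Definition cone d F G (u : {mpoly K[n]})
    (c : forall i, 'M[{mpoly K[n]}]_(augm_rank G i, augm_rank F i)) : free_complex K n :=
  @FreeComplex K n (cone_rank F G)
    (fun i a => match split a with
                | inl b => res_deg b
                | inr b => (d + augm_deg b)%N
                end)
    (col_mx (res_aug F) u%:M)
    (fun i => block_mx (res_diff F i) 0 (c i.+1) (- augm_diff G i)).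

(** The cone resolves I = J + (u) because 0 -> S/(J : u)(-d) -> S/J -> S/I -> 0
    is exact.  The resolution G of J : u is linear with ranks 'C(r, i.+1), as for
    an ideal of r variables; the comparison map goes from twist d + i to twists
    below it, hence has no constant entries. *)
Lemma mapping_cone I J I' F G d r (u : {mpoly K[n]}) :
  minimal_graded_resolution J F -> minimal_graded_resolution I' G ->
  u \is d.-homog ->
  (forall i (a : 'I_(res_rank F i)), res_deg a <= d + i)%N ->
  (forall i j, betti G i j = (j == i.+1) * 'C(r, i.+1))%N ->
  (forall p, I p <-> exists q, J (p - q * u)) ->
  (forall p, J (p * u) <-> I' p) ->
  exists H, minimal_graded_resolution I H /\
    forall i j, (betti H i j = betti F i j + (j == d + i) * 'C(r, i))%N.
Proof.
move=> hF hG hu dF bG hI hI'.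
have [c [c0 gc cc]] := chain_lift hG hF hu (fun p => (hI' p).2).
have degG i (a : 'I_(res_rank G i)) : res_deg a = i.+1.
  apply/eqP; have := bG i (res_deg a).
  case: eqP => // _ /eqP; rewrite mul0n cards_eq0 => /eqP/setP/(_ a).
  by rewrite !inE eqxx.
have augm_degG i (a : 'I_(augm_rank G i)) : augm_deg a = i.
  by case: i a => [|i] a //; apply: degG.
have rG i : res_rank G i = 'C(r, i.+1).
  have := bG i i.+1; rewrite eqxx mul1n => <-.
  by rewrite betti_sum (eq_bigr (fun=> 1%N)) ?sum_nat_const ?card_ord ?muln1 // => a _;
     rewrite degG eqxx.
exists (cone d u c); split; last first.
  move=> i j; rewrite !betti_sum big_split_ord /=; congr (_ + _)%N.
    by apply: eq_bigr => a _; rewrite (unsplitK (inl a)).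
  under eq_bigr => a _ do rewrite (unsplitK (inr a)).
  case: i => [|i] /=; first by rewrite big_ord1 bin0 muln1 eq_sym.
  rewrite -(rG i) (eq_bigr (fun=> (j == d + i.+1)%N : nat)); last first.
    by move=> a _; rewrite degG eq_sym.
  by rewrite sum_nat_const card_ord mulnC.
pose M i := block_mx (res_diff F i) 0 (c i.+1) (- augm_diff G i).
have key i (f : 'rV_(res_rank F i)) (g : 'rV_(augm_rank G i)) :
    f *m augm_diff F i + g *m c i = 0 -> (exists w, g = w *m augm_diff G i) ->
    exists W, row_mx f g = W *m M i.
  move=> E [w hw].
  have [|w' hw'] := (augm_diff_exact_row (i := i) (f + w *m c i.+1) hF).1.
    by rewrite mulmxDl -mulmxA -cc mulmxA -hw.
  exists (row_mx w' (- w)); rewrite mul_row_block mulmx0 add0r -[w' *m _]hw'.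
  by rewrite mulNmx addrK mulmxN mulNmx opprK -hw.
have comp i : M i.+1 *m M i = 0.
  have E1 : res_diff F i.+1 *m res_diff F i = 0 := augm_diff_comp i.+1 hF.
  have E2 : augm_diff G i.+1 *m augm_diff G i = 0 := augm_diff_comp i hG.
  have E3 : augm_diff G i.+1 *m c i.+1 = c i.+2 *m res_diff F i := cc i.+1.
  rewrite /M mulmx_block !(mulmx0, mul0mx, addr0, add0r, mulNmx, mulmxN, opprK).
  by rewrite E1 E2 E3 subrr block_mx0.
split=> /=.
- move=> a; rewrite mxE; case: split => b; first exact: (aug_homog hF).
  by rewrite mxE (ord1 b) mulr1n addn0.
- move=> i a b; apply/twist_homogP; rewrite mxE.
  case: (split a) => a'; rewrite mxE; case: (split b) => b'.
  + by apply/twist_homogP; apply: (diff_homog hF).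
  + by rewrite mxE; apply: twist_homog0.
  + exact: (gc i.+1).
  + rewrite mxE; apply: twist_homogN => m /(augm_diff_graded (i := i) hG) E.
    by rewrite addnCA E.
- move=> p; split=> [/hI [q]|[v ->]].
    move/(aug_image hF) => [v hv]; exists (row_mx v q%:M).
    by rewrite mul_row_col mul_mx_scalar scale_scalar_mx mxE -hv mxE mulr1n [u * q]mulrC subrK.
  apply/hI; rewrite -[v]hsubmxK mul_row_col mul_mx_scalar; exists (rsubmx v 0 0).
  apply/(aug_image hF); exists (lsubmx v).
  by rewrite [X in X - _]mxE [X in _ + X - _]mxE [u * _]mulrC addrK.
- move=> v; split=> [|[w ->]]; last first.
    rewrite -mulmxA mul_block_col mul0mx addr0 mulNmx.
    have -> : res_diff F 0 *m res_aug F = 0 := augm_diff_comp 0 hF.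
    have <- : augm_diff G 0 *m u%:M = c 1%N *m res_aug F by rewrite -c0 (cc 0%N).
    by rewrite addrN col_mx0 mulmx0.
  rewrite -[v]hsubmxK mul_row_col mul_mx_scalar.
  set f := lsubmx v; set g := rsubmx v => E.
    apply: (key 0%N); first by rewrite c0 mul_mx_scalar.
    have /hI' : J (g 0 0 * u).
      apply/(aug_image hF); exists (- f); move: E => /matrixP/(_ 0 0).
      by rewrite mulNmx !mxE mulrC => /eqP; rewrite addrC addr_eq0 => /eqP.
    move/(aug_image hG)=> [w hw]; exists w.
    by apply/matrixP=> a b; rewrite (ord1 a) (ord1 b).
- move=> i v; split=> [|[w ->]]; last by rewrite -mulmxA (comp i) mulmx0.
  rewrite -[v]hsubmxK mul_row_block mulmx0 add0r -[X in _ = X -> _]row_mx0.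
  case/eq_row_mx => E1 E2; apply: (key i.+1) => //.
  apply/(augm_diff_exact_row _ hG); move/eqP: E2; rewrite mulmxN oppr_eq0 => /eqP //.
- move=> i a b; rewrite mxE.
  case: (split a) => a'; rewrite mxE; case: (split b) => b'.
  + exact: (diff_minimal hF).
  + by rewrite mxE mcoeff0.
  + apply/eqP/negPn/negP => h.
    have : const_term (c i.+1) a' b' != 0 by rewrite mxE.
    move/(const_term_graded (gc i.+1)) => E.
    by have := dF i b'; rewrite -[res_deg b']E augm_degG leq_add2l ltnn.
  + rewrite mxE mcoeffN; apply/eqP; rewrite oppr_eq0; apply/negPn/negP => h.
    have : const_term (augm_diff G i) a' b' != 0 by rewrite mxE.
    move/(const_term_graded (augm_diff_graded (i := i) hG)) => E.
    by move: E; rewrite !augm_degG => /eqP; rewrite eqn_leq ltnn.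
Qed.
End Resolutions.

(** * Monomial ideals with linear quotients *)

Section MonomialIdeals.
Variables (K : fieldType) (n : nat).
Implicit Types (p q : {mpoly K[n]}) (m : 'X_{1..n}) (s t : seq {set 'I_n})
  (u v X : {set 'I_n}).

Definition mnm_vars m : {set 'I_n} := [set i | (0 < m i)%N].

(** In a monomial ideal membership is decided monomial by monomial, so the ideal
    generated by the x_v, v in s, is given in this form. *)
Definition mon_ideal s p : Prop :=
  forall m, m \in msupp p -> has (fun v => v \subset mnm_vars m) s.

Lemma mnm_varsD m u : mnm_vars (m + mesym1 u) = mnm_vars m :|: u.
Proof.
apply/setP=> i; rewrite !inE mnmDE mnmE addn_gt0; congr (_ || _).
by case: (i \in u).
Qed.

Lemma mnm_vars_mesym1 u : mnm_vars (mesym1 u) = u.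
Proof. by apply/setP=> i; rewrite !inE mnmE; case: (i \in u). Qed.

Lemma mesym1_le u m : u \subset mnm_vars m -> (mesym1 u <= m)%MM.
Proof.
move=> /subsetP h; apply/mnm_lepP => i; rewrite mnmE.
by case: (boolP (i \in u)) => // /h; rewrite inE.
Qed.

Lemma sqfree_monomialE u : sqfree_monomial K u = 'X_[mesym1 u].
Proof.
rewrite /sqfree_monomial mprodXE; congr 'X_[_]; apply/mnmP=> i.
rewrite mnm_sumE mnmE big_mkcond (bigD1 i) //= mnm1E eqxx big1 ?addn0 => [|j ne_ji].
  by case: (i \in u).
by case: (_ \in _); rewrite // mnm1E (negbTE ne_ji).
Qed.

Lemma mon_ideal_rcons s u p :
  mon_ideal (rcons s u) p <-> exists q, mon_ideal s (p - q * 'X_[mesym1 u]).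
Proof.
split=> [h|[q h] m hm]; last first.
  rewrite has_rcons; have [/h ->|] := boolP (m \in msupp (p - q * 'X_[mesym1 u])).
    by rewrite orbT.
  rewrite -mcoeff_eq0 mcoeffB subr_eq0 => /eqP E.
  move: hm; rewrite mcoeff_msupp E -mcoeff_msupp (perm_mem (msuppMX _ _)).
  by case/mapP=> m' _ ->; rewrite addmC mnm_varsD subsetUr.
exists (\sum_(m <- msupp p | u \subset mnm_vars m) p@_m *: 'X_[m - mesym1 u]).
have -> : p - (\sum_(m <- msupp p | u \subset mnm_vars m) p@_m *: 'X_[m - mesym1 u]) * 'X_[mesym1 u]
   = mono_part (fun m => ~~ (u \subset mnm_vars m)) p.
  rewrite mulr_suml {1}[p]mpolyE (bigID (fun m => u \subset mnm_vars m)) /=.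
  rewrite addrAC [X in X + _](_ : _ = 0) ?add0r // -sumrB big1 // => m hm.
  by rewrite -scalerAl -mpolyXD submK ?mesym1_le // subrr.
move=> m; rewrite mcoeff_msupp mcoeff_mono_part.
case: ifP => [hu|]; last by rewrite eqxx.
by rewrite -mcoeff_msupp => /h; rewrite has_rcons (negbTE hu).
Qed.

(** Multiplying by x_u translates supports by u, so membership can be tested on
    supports X of monomials alone. *)
Lemma mon_ideal_colon s t u p :
  (forall X, has (fun v => v \subset X :|: u) s = has (fun v => v \subset X) t) ->
  mon_ideal s (p * 'X_[mesym1 u]) <-> mon_ideal t p.
Proof.
move=> h; split=> H m hm.
  rewrite -h -mnm_varsD; apply: H; rewrite (perm_mem (msuppMX _ _)).
  by rewrite addmC map_f.
move: hm; rewrite (perm_mem (msuppMX _ _)) => /mapP[m' /H + ->].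
by rewrite -h -mnm_varsD addmC.
Qed.

Lemma mon_ideal_nil p : mon_ideal [::] p <-> p = 0.
Proof.
split=> [h|-> m]; last by rewrite msupp0.
apply/eqP; rewrite -msupp_eq0; case E: (msupp p) => [//|m r].
by have := h m; rewrite E inE eqxx => /(_ isT).
Qed.

Definition zero_complex : free_complex K n :=
  @FreeComplex K n (fun=> 0%N) (fun _ _ => 0%N) 0 (fun=> 0).

Lemma zero_complex_resolves : minimal_graded_resolution (mon_ideal [::]) zero_complex.
Proof.
split=> /=.
- by case.
- by move=> i [].
- move=> p; rewrite mon_ideal_nil; split=> [->|[v ->]]; last by rewrite mulmx0 mxE.
  by exists 0; rewrite mulmx0 mxE.
- by move=> v; rewrite mulmx0; split=> // _; exists 0; rewrite mulmx0 [v]thinmx0.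
- by move=> i v; rewrite mulmx0; split=> // _; exists 0; rewrite mulmx0 [v]thinmx0.
- by move=> i [].
Qed.

(** The Koszul complex, as an iterated cone: each variable is a nonzerodivisor
    modulo the previous ones, so the colon ideal equals the ideal already
    resolved and G = F in the cone. Pascal's rule gives the ranks. *)
Lemma variables_resolution (r : seq 'I_n) : uniq r ->
  exists F, minimal_graded_resolution (mon_ideal [seq [set k] | k <- r]) F /\
    forall i j, betti F i j = ((j == i.+1) * 'C(size r, i.+1))%N.
Proof.
elim/last_ind: r => [|r k IH].
  exists zero_complex; split; first exact: zero_complex_resolves.
  by move=> i j; rewrite muln0 betti_sum big_ord0.
rewrite rcons_uniq => /andP[kr /IH[F [hF bF]]].
have hd : ('X_[mesym1 [set k]] : {mpoly K[n]}) \is 1.-homog.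
  by rewrite dhomogX; apply/eqP; apply: etrans (mdeg_mesym1 _) (cards1 _).
have [|||H [hH bH]] := mapping_cone (I := mon_ideal [seq [set k] | k <- rcons r k])
  (r := size r) hF hF hd _ bF.
- move=> i a; have [->//|ne] := eqVneq (res_deg a) i.+1.
  have /eqP := bF i (res_deg a); rewrite (negbTE ne) mul0n cards_eq0.
  by move/eqP/setP/(_ a); rewrite !inE eqxx.
- by move=> p; rewrite map_rcons; apply: mon_ideal_rcons.
- move=> p; apply: mon_ideal_colon => X; apply: eq_in_has => v /mapP[k' hk' ->].
  by rewrite !sub1set !inE (_ : (k' == k) = false) ?orbF //; apply: contraNF kr => /eqP <-.
exists H; split=> // i j; rewrite bH bF size_rcons binS mulnDr add1n.
by [].
Qed.

(** The generators are added in the order of s; since their degrees do not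
    decrease, the degree bound of [mapping_cone] holds at every stage. *)
Lemma linear_quotients_resolution s (A : {set 'I_n} -> {set 'I_n}) :
  (forall s1 u s2, s = s1 ++ u :: s2 ->
     {in s1, forall v, #|v| <= #|u|}%N /\
     forall X, has (fun v => v \subset X :|: u) s1 = (X :&: A u != set0)) ->
  exists F, minimal_graded_resolution (mon_ideal s) F /\
    forall i j, betti F i j = (\sum_(u <- s) (j == #|u| + i) * 'C(#|A u|, i))%N.
Proof.
elim/last_ind: s => [|s u IH] hs.
  exists zero_complex; split; first exact: zero_complex_resolves.
  by move=> i j; rewrite big_nil betti_sum big_ord0.
have [|F [hF bF]] := IH.
  by move=> s1 v s2 E; apply: (hs s1 v (rcons s2 u)); rewrite E rcons_cat.
have [hcard hcol] : {in s, forall v, #|v| <= #|u|}%N /\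
     forall X, has (fun v => v \subset X :|: u) s = (X :&: A u != set0).
  by apply: (hs s u [::]); rewrite cats1.
have [G [hG bG]] := variables_resolution (enum_uniq (mem (A u))).
have hd : ('X_[mesym1 u] : {mpoly K[n]}) \is #|u|.-homog.
  by rewrite dhomogX; apply/eqP; apply: mdeg_mesym1.
rewrite -cardE in bG.
have [|||H [hH bH]] := mapping_cone (I := mon_ideal (rcons s u)) hF hG hd _ bG.
- move=> i a; have [|] := boolP (has (fun v => res_deg a == #|v| + i)%N s).
    by case/hasP=> v /hcard hv /eqP ->; rewrite leq_add2r.
  move/hasPn=> h; have /eqP := bF i (res_deg a).
  rewrite big_seq big1 => [|v /h/negbTE->]; last by rewrite mul0n.
  by rewrite cards_eq0 => /eqP/setP/(_ a); rewrite !inE eqxx.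
- by move=> p; apply: mon_ideal_rcons.
- move=> p; apply: mon_ideal_colon => X; rewrite hcol has_map.
  apply/set0Pn/hasP => [[k]|[k]]; rewrite ?inE ?mem_enum /=.
    by case/andP=> kX kA; exists k; rewrite ?mem_enum //= sub1set.
  by move=> kA kX; exists k; rewrite inE kA andbT -sub1set.
by exists H; split=> // i j; rewrite bH bF -cats1 big_cat big_seq1.
Qed.

End MonomialIdeals.

(** * Stanley-Reisner ideals of stable complexes *)

Section StanleyReisner.
Variables (K : fieldType) (n : nat).
Implicit Types (D : {set {set 'I_n}}) (p : {mpoly K[n]}) (s : {set 'I_n}).

Lemma ideal_generated_sqfreeP (T : finType) (A : {set T}) (g : T -> {set 'I_n}) p :
  ideal_generated A (fun t => sqfree_monomial K (g t)) p <->
  forall m, m \in msupp p -> exists2 t, t \in A & g t \subset mnm_vars m.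
Proof.
split=> [[c ->] m|h].
  suff: (m \in msupp (\sum_(t in A) c t * sqfree_monomial K (g t))) ->
        has (fun t => (t \in A) && (g t \subset mnm_vars m)) (enum T).
    by move=> H /H /hasP[t _ /andP[tA gt]]; exists t.
  apply: contraTT => /hasPn h; rewrite -mcoeff_eq0 raddf_sum /= big1 // => t tA.
  apply/eqP; rewrite mcoeff_eq0 sqfree_monomialE (perm_mem (msuppMX _ _)).
  have := h t (mem_enum _ _); rewrite tA /=; apply: contra => /mapP[m' _ ->].
  by rewrite addmC mnm_varsD subsetUr.
rewrite [p]mpolyE big_seq.
apply: (big_ind (ideal_generated A (fun t => sqfree_monomial K (g t)))).
- by exists (fun=> 0); rewrite big1 // => t _; rewrite mul0r.
- move=> q r [c ->] [d ->]; exists (fun t => c t + d t); rewrite -big_split /=.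
  by apply: eq_bigr => t _; rewrite mulrDl.
move=> m /h[t tA gt].
exists (fun t' => if t' == t then p@_m *: 'X_[m - mesym1 (g t)] else 0).
rewrite (bigD1 t) //= eqxx big1 ?addr0 => [|t' /andP[_ /negbTE->]]; last by rewrite mul0r.
by rewrite sqfree_monomialE -scalerAl -mpolyXD submK ?mesym1_le.
Qed.

Lemma stanley_reisnerP D p :
  stanley_reisner K D p <->
  forall m, m \in msupp p -> exists2 s, s \in ~: D & s \subset mnm_vars m.
Proof. exact: (ideal_generated_sqfreeP (~: D) id p). Qed.

Lemma ideal_generated_sqfree_set (T : finType) (A : {set T}) (g : T -> {set 'I_n}) s :
  ideal_generated A (fun t => sqfree_monomial K (g t)) 'X_[mesym1 s] <->
  exists2 t, t \in A & g t \subset s.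
Proof.
rewrite ideal_generated_sqfreeP; split=> [|h m]; last first.
  by rewrite msuppX inE => /eqP->; rewrite mnm_vars_mesym1.
by move/(_ (mesym1 s)); rewrite msuppX inE eqxx mnm_vars_mesym1 => /(_ isT).
Qed.

Lemma simplicial_up_closed D : simplicial_complex D -> up_closed (~: D).
Proof. by case=> h _ s t; rewrite !inE => sD st; apply: contra sD => /h; apply. Qed.

Lemma stable_complex_family D : simplicial_complex D -> stable_complex K D ->
  stable_family (~: D).
Proof.
move=> hD hst s l i sD ls El il is_.
have sup j : (0 < mesym1 s j)%N = (j \in s) by rewrite mnmE; case: (j \in s).
have h1 : stanley_reisner K D ('X_[mesym1 s]).
  by apply/(ideal_generated_sqfree_set _ id); exists s.
have h2 : max_var (mesym1 s) l.
  by split=> [|j]; rewrite sup => // /ltn_set_top; rewrite El ltnS.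
have h3 j : (mesym1 s j <= 1)%N by rewrite mnmE; case: (j \in s).
have h4 : mesym1 s i = 0%N by rewrite mnmE (negbTE is_).
have /stanley_reisnerP := hst _ l i h3 h2 h1 il h4.
case/(_ (U_(i) + (mesym1 s - U_(l)))%MM); first by rewrite msuppX inE.
move=> t tD ts; apply: (simplicial_up_closed hD) tD _; apply: subset_trans ts _.
apply/subsetP=> x; rewrite !inE mnmDE mnmBE !mnm1E mnmE ![x == _]eq_sym.
by case: (i == x); case: (l == x) => //=; case: (x \in s).
Qed.

Lemma shift_nonfaces_is_shift (k l : 'I_n) D D' : simplicial_complex D -> (k < l)%N ->
  is_shift K k l D D' -> ~: D' = shift_nonfaces (~: D) k l.
Proof.
move=> hD kl [hD' hI]; have kl' : k != l by rewrite -val_eqE neq_ltn kl.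
apply/setP=> s.
have E1 : s \in ~: D' <-> exists2 t, t \in ~: D' & t \subset s.
  by split=> [sD|[t tD ts]]; [exists s|exact: simplicial_up_closed hD' _ _ tD ts].
have E2 := iff_trans (iff_sym (ideal_generated_sqfree_set (~: D') id s))
   (iff_trans (hI _) (ideal_generated_sqfree_set (~: D) (shift_set D k l) s)).
apply/idP/idP => [/E1/E2[t tD ts]|/(shift_nonfacesP kl')[t tD E]].
  apply: (shift_nonfaces_up (simplicial_up_closed hD) kl') ts.
  exact: (mem_shift_fun kl' tD).
by apply/E1/E2; exists t => //; rewrite -E.
Qed.

(** Stability is part of the invariant: without it a shift could lower the
    largest vertex of a nonface. *)
Lemma iterated_shift_invariants D D' : simplicial_complex D ->
  stable_family (~: D) -> iterated_shift K D D' ->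
  [/\ simplicial_complex D', stable_family (~: D') &
    forall f : nat -> nat -> nat, \sum_(s in ~: D') f #|s| (set_top s)
      = \sum_(s in ~: D) f #|s| (set_top s)].
Proof.
move=> hD hst; elim=> [k l {}D' kl sh|k l {}D' D'' _ [hD' hst' E] kl sh].
  have E := shift_nonfaces_is_shift hD kl sh.
  split; rewrite ?E; [exact: sh.1|exact: stable_shift|].
  by move=> f; apply: sum_shift_nonfaces.
have E' := shift_nonfaces_is_shift hD' kl sh.
split; rewrite ?E'; [exact: sh.1|exact: stable_shift|].
by move=> f; rewrite -E; apply: sum_shift_nonfaces.
Qed.

Lemma resolution_ext (I J : {mpoly K[n]} -> Prop) F : (forall p, I p <-> J p) ->
  minimal_graded_resolution I F -> minimal_graded_resolution J F.
Proof. by move=> h [? ? hI ? ? ?]; split=> // p; rewrite -h hI. Qed.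

Lemma graded_bettiE (I : {mpoly K[n]} -> Prop) F i j :
  minimal_graded_resolution I F -> graded_betti I i j = betti F i j.
Proof.
move=> hF; rewrite /graded_betti.
set P := fun b => _.
have [|G [hG ->]] := epsilon_spec (inhabits 0%N) P; first by exists (betti F i j), F.
exact: betti_unique hG hF.
Qed.

(** The contribution of a minimal nonface of size d with largest vertex t: the
    bracketed cardinal minus d is the number of gaps below t. *)
Definition stable_betti i j (d t : nat) : nat :=
  ((j == d + i) * 'C(#|[set k : 'I_n | k < t]| - d, i))%N.

Lemma graded_betti_stable D i j : simplicial_complex D -> stable_family (~: D) ->
  graded_betti (stanley_reisner K D) i j =
  (\sum_(u in min_sets (~: D)) stable_betti i j #|u| (set_top u))%N.
Proof.
move=> /simplicial_up_closed hup hst.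
have [F [hF bF]] := linear_quotients_resolution K 
  (fun q u r => stable_linear_quotients (s1 := q) (s2 := r) (u := u) hup hst).
have {}hF : minimal_graded_resolution (stanley_reisner K D) F.
  apply: resolution_ext hF => p; rewrite stanley_reisnerP.
  split=> h m /h; first case/hasP=> v; rewrite ?mem_sorted_min_sets.
    by move=> /(min_setsP _ hup)[vN _] vm; exists v.
  case=> s /min_sets_below[t tG ts] sm; apply/hasP; exists t; rewrite ?mem_sorted_min_sets //.
  exact: subset_trans ts sm.
rewrite (graded_bettiE _ _ hF) bF (perm_big (enum (min_sets (~: D)))) /=; last first.
  by rewrite perm_sort.
by rewrite big_enum; apply: eq_bigr => u _; rewrite card_lower_gaps.
Qed.
End StanleyReisner.

Theorem theorem2p3 (K : fieldType) (hK : infinite_field K) (n : nat)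
    (D Dc : {set {set 'I_n}}) (hD : simplicial_complex D)
    (hstable : stable_complex K D) (hDc : combinatorial_shifted K D Dc) :
  forall i j : nat,
    graded_betti (stanley_reisner K D) i j
    = graded_betti (stanley_reisner K Dc) i j.
Proof.
move=> i j; have hst := stable_complex_family hD hstable.
have [hDc' hst' E] := iterated_shift_invariants hD hst hDc.1.
rewrite !graded_betti_stable //.
pose f := stable_betti n i j.
(* The correction term of [sum_min_sets], as a function of size and top. *)
pose g d t := (\sum_(l : 'I_n | t <= l) f d.+1 l.+1)%N.
apply: (@addIn (\sum_(t in ~: D) g #|t| (set_top t))%N).
rewrite (sum_min_sets f (simplicial_up_closed hD) hst) -(E g).
by rewrite (sum_min_sets f (simplicial_up_closed hDc') hst') E.
Qed.
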